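(* Let every hexagon of the $3$-ring be assigned an arbitrary height value in $\mathbb Z_3$. Then there is an assignment of height values in $\mathbb Z_3$ to the $7$ hexagons of the $2$-disc enclosed by the $3$-ring such that, in the resulting height configuration on the whole $3$-disc ($19$ hexagons), no three mutually adjacent hexagons have the same height value. (Equivalently: every $\mathbb Z_3$ Gauss-law-respecting boundary configuration of this block is admissible, i.e. has a realization in the interior without forbidden vertices.)
   Context: Consider the tiling of the plane by regular hexagons (plaquettes of the honeycomb lattice). Two hexagons are adjacent if they share an edge; three mutually adjacent hexagons are three hexagons meeting at a common vertex. Fix a central hexagon. The $n$-ring is the set of hexagons at distance exactly $n-1$ from the central one in the adjacency graph (so the $1$-ring is the central hexagon itself, and for $n\ge 2$ the $n$-ring is a hexagon-shaped ring of $6n-6$ hexagons). The $n$-disc is the union of all $m$-rings with $m\le n$. A height configuration on a set of hexagons assigns an element of $\mathbb Z_3=\{0,1,2\}$ to each of them. Link variables on the honeycomb edges are the oriented differences of the heights of the two hexagons sharing the edge; they satisfy a $\mathbb Z_3$ Gauss law at each vertex, and three equal heights around a vertex correspond to the forbidden vertex configuration $000$. *)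

(* Defs.v *)
From mathcomp Require Import all_boot all_order all_algebra.

Set Implicit Arguments.
Unset Strict Implicit.
Unset Printing Implicit Defensive.

Import GRing.Theory.
Local Open Scope ring_scope.

(* Points of the plane are written in coordinates (a, b), standing for a + b z
   with z = exp(i pi / 3). Hexagons have side 1: the hexagon of index (x, y)
   is centred at x (1 + z) + y (-1 + 2z), where 1 + z and -1 + 2z are two
   vectors of length sqrt 3 at angle pi / 3, and its corners are the centre
   plus the six powers of z. These hexagons tile the plane. *)
Definition point := (int * int)%type.
Definition hexagon := (int * int)%type.

Definition center (h : hexagon) : point := (h.1 - h.2, h.1 + 2 * h.2).

(* 1, z, z^2, ..., z^5: counterclockwise order, using z^2 = z - 1. *)
Definition hex_units : seq point :=
  [:: (1, 0); (0, 1); (-1, 1); (-1, 0); (0, -1); (1, -1)].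

Definition corners (h : hexagon) : seq point :=
  [seq ((center h).1 + u.1, (center h).2 + u.2) | u <- hex_units].

Definition edges (h : hexagon) : seq (point * point) :=
  zip (corners h) (rot 1 (corners h)).

(* Edges are unoriented, while [edges] lists them with an orientation. *)
Definition share_edge (h k : hexagon) : bool :=
  has (fun e => (e \in edges k) || ((e.2, e.1) \in edges k)) (edges h).

Definition adjacent : rel hexagon := [rel h k | (h != k) && share_edge h k].

Definition walk (h k : hexagon) (d : nat) : Prop :=
  exists p : seq hexagon, [/\ path adjacent h p, last h p = k & size p = d].

Definition at_distance (h k : hexagon) (d : nat) : Prop :=
  walk h k d /\ forall d' : nat, walk h k d' -> (d <= d')%N.

(* The condition 0 < n rules out the junk value 0.-1 = 0. *)
Definition ring (c : hexagon) (n : nat) (h : hexagon) : Prop :=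
  (0 < n)%N /\ at_distance c h n.-1.

Definition disc (c : hexagon) (n : nat) (h : hexagon) : Prop :=
  exists2 m : nat, (m <= n)%N & ring c m h.

(* A height configuration on a set of hexagons is represented by a function on
   all hexagons, of which only the values on that set are used. *)
Definition heights := hexagon -> 'Z_3.

Definition no_monochromatic_triple (A : hexagon -> Prop) (f : heights) : Prop :=
  forall h1 h2 h3 : hexagon, A h1 -> A h2 -> A h3 ->
    adjacent h1 h2 -> adjacent h2 h3 -> adjacent h1 h3 ->
    ~ (f h1 = f h2 /\ f h2 = f h3).

(* Main.v *)
Require Import Defs.
From mathcomp Require Import all_boot all_order all_algebra.
From mathcomp Require Import zify.

(** A hexagon of the 2-ring lies in two triples with hexagons of the 3-ring
    only, and both contain the corner of the 3-ring behind it. So it suffices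
    to colour the six hexagons of the 2-ring so that consecutive ones differ
    and each differs from the corner behind it: every triple of the 3-disc then
    contains two hexagons known to differ, whatever the height of the centre.
    Each hexagon of the 2-ring is thus left with two colours, and such a
    colouring exists because even cycles are 2-choosable. *)

Set Implicit Arguments.
Unset Strict Implicit.
Unset Printing Implicit Defensive.

Import GRing.Theory.
Local Open Scope ring_scope.

Lemma Z3_avoid2 (x y : 'Z_3) : {z : 'Z_3 | (z != x) && (z != y)}.
Proof.
apply: sigW.
by case: x y => [[|[|[]]] //= ?] [[|[|[]]] //= ?];
  do [by exists 0 | by exists 1 | by exists 2%:R].
Qed.

(* If the forbidden colours are not all equal, some [L i] differs from
   [L (i + 1)]: colour [i + 1] with [L i] and go around greedily; the last
   vertex [i] then differs from [i + 1] because it avoids [L i]. *)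
Lemma even_cycle_avoiding_coloring (n : nat) (L : 'I_n.+2 -> 'Z_3) :
  ~~ odd n ->
  exists r : 'I_n.+2 -> 'Z_3, forall i, (r i != L i) && (r i != r (i + 1)).
Proof.
move=> even_n.
have valS (j : 'I_n.+2) : val (j + 1) = if (j < n.+1)%N then j.+1 else 0%N.
  rewrite /= modnDmr addn1; case: ltnP => [lt_jn | le_nj].
    by rewrite modn_small.
  by have -> : nat_of_ord j = n.+1; [have := ltn_ord j; lia | rewrite modnn].
have [/forallP eqL | /forallPn[i neqL]] := boolP [forall i, L i == L (i + 1)].
  have L0 (j : 'I_n.+2) : L j = L 0.
    rewrite -[j]natr_Zp; elim: (nat_of_ord j) => [//|m IH].
    by rewrite mulrSr -IH; apply/esym/eqP.
  (* All forbidden colours equal [L 0]: alternate the other two. As the cycle is even, its last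
     vertex also differs from vertex 0. *)
  exists (fun j => L 0 + if odd j then 1 else - 1) => j.
  rewrite L0 -subr_eq0 addrC addKr (inj_eq (addrI _)) valS.
  case: (ltnP j n.+1) => [_ /= | le_nj]; first by case: odd.
  have -> : nat_of_ord j = n.+1 by have := ltn_ord j; lia.
  by rewrite /= even_n.
(* [s m] will colour the vertex [i + 1 + m]. *)
pose s := fix s m := if m is m'.+1
  then sval (Z3_avoid2 (s m') (L (i + 1 + m%:R))) else L i.
have sS m : (s m.+1 != s m) && (s m.+1 != L (i + 1 + m.+1%:R)).
  exact: (svalP (Z3_avoid2 (s m) (L (i + 1 + m.+1%:R)))).
exists (fun j => s (val (j - (i + 1)))) => j.
set k := j - (i + 1).
have -> : j + 1 - (i + 1) = k + 1 by rewrite /k addrAC.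
have -> : j = i + 1 + k by rewrite /k addrC subrK.
have Ek : i + 1 + k = i + 1 + (val k)%:R by rewrite natr_Zp.
apply/andP; split.
  rewrite Ek; case: (val k) => [|m]; last by case/andP: (sS m).
  by rewrite addr0.
rewrite valS; case: ltnP => [_ | le_nk].
  by rewrite eq_sym; case/andP: (sS (val k)).
have valk : val k = n.+1 by move: le_nk (ltn_ord k) => /=; lia.
(* After [n + 1] steps from [i + 1] the cycle is back at [i], whose colour avoids [L i], the colour
   of [i + 1]. *)
have -> : s 0%N = L (i + 1 + (val k)%:R).
  rewrite valk -addrA -mulrS; congr L.
  by rewrite -[LHS]addr0; congr (_ + _); apply/esym/(@pchar_Zp n.+2).
by rewrite valk; case/andP: (sS n).
Qed.

(* In the basis 1 + z, -1 + 2z used to index hexagons, the six neighbours have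
   the same coordinates as the powers of z in the basis 1, z; the edge shared
   with the i-th neighbour is the i-th edge of [h]. *)
Lemma adjacentE (h k : hexagon) : adjacent h k = (k - h \in hex_units).
Proof.
rewrite -{1}(subrK h k) addrC; move: (k - h) => d.
rewrite /adjacent /= -[X in X != _]addr0 (inj_eq (addrI h)) eq_sym; apply/andP/idP => [[d_neq0] | dU].
  case: h d d_neq0 => [a b] [x y] d_neq0 /hasP[e he /orP[] hk];
    move: he hk; rewrite /edges /corners /center /= !inE;
    do 5?[case/orP]; move/eqP=> -> /=; do 5?[case/orP];
    rewrite !xpair_eqE => /andP[/andP[/eqP e1 /eqP e2] /andP[/eqP e3 /eqP e4]];
    move: d_neq0; rewrite xpair_eqE; lia.
split; first by apply: contraTneq dU => ->.
pose i := index d hex_units; pose p := (h, h).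
have lti : (i < 6)%N by rewrite index_mem.
have defd : d = nth 0 hex_units i by rewrite nth_index.
apply/hasP; exists (nth p (edges h) i); first by rewrite mem_nth.
(* Seen from the neighbour, the shared edge is the opposite one, [i + 3], with reversed
   orientation. *)
apply/orP; right; suff -> : ((nth p (edges h) i).2, (nth p (edges h) i).1) =
  nth p (edges (h + d)) ((i + 3) %% 6) by rewrite mem_nth // ltn_mod.
rewrite defd; case: i lti {defd dU} => [|[|[|[|[|[|]]]]]] //= _.
all: by case: h @p => a b p; rewrite /center /=; congr ((_, _), (_, _)); lia.
Qed.

Definition ball2 : seq hexagon :=
  [seq u + v | u <- (0, 0) :: hex_units, v <- (0, 0) :: hex_units].

Lemma disc3_ball2 (c h : hexagon) : disc c 3 h -> h - c \in ball2.
Proof.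
case=> m le_m3 [m_gt0 [[p [pth <- szp]] _]].
have {m m_gt0 le_m3 szp} : (size p <= 2)%N by lia.
case: p pth => [|h1 [|h2 [|//]]]; rewrite /= ?adjacentE ?andbT.
- by rewrite subrr.
- move=> u _; rewrite -[_ - _]addr0; apply: allpairs_f => //.
  by rewrite inE u orbT.
case/andP=> u v _; rewrite -(subrKA h1) addrC.
by apply: allpairs_f; rewrite inE ?u ?v orbT.
Qed.

(** Ensures that recolouring the neighbours of [c] leaves the 3-ring untouched. *)
Lemma ring3_not_adjacent (c h : hexagon) : ring c 3 h -> ~~ adjacent c h.
Proof.
case=> _ [_ min_h]; apply/negP => ch; suff /min_h : walk c h 1 by [].
by exists [:: h]; rewrite /= ch.
Qed.

(* [p + p] is the corner of the 3-ring behind [p]. *)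
Definition kept_apart (p q : hexagon) : bool :=
  (p \in hex_units) &&
  ((q == p + p) ||
   (q \in hex_units) && (index q hex_units == (index p hex_units).+1 %% 6)%N).

Lemma triple_kept_apart (p q s : hexagon) :
  p \in ball2 -> q \in ball2 -> s \in ball2 ->
  q - p \in hex_units -> s - q \in hex_units -> s - p \in hex_units ->
  [|| kept_apart p q, kept_apart q p, kept_apart q s, kept_apart s q,
      kept_apart p s | kept_apart s p].
Proof.
(* Writing [q = p + u] and [s = p + v] leaves finitely many triples to test. *)
have chk : all (fun p => all (fun u => all (fun v =>
    [==> p + u \in ball2, p + v \in ball2, v - u \in hex_units =>
      let q := p + u in let s := p + v in
      [|| kept_apart p q, kept_apart q p, kept_apart q s, kept_apart s q,
          kept_apart p s | kept_apart s p]])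
    hex_units) hex_units) ball2 by vm_compute.
move=> pB qB sB qp sq sp.
move/allP/(_ p pB)/allP/(_ _ qp)/allP/(_ _ sp): chk.
rewrite ![p + _]addrC !subrK.
have -> : s - p - (q - p) = s - q by rewrite opprB addrA subrK.
by rewrite qB sB sq.
Qed.

Theorem mainTheorem2 (c : hexagon) (b : heights) :
  exists f : heights,
    (forall h : hexagon, ring c 3 h -> f h = b h) /\
    no_monochromatic_triple (disc c 3) f.
Proof.
pose dir (i : 'I_6) : hexagon := nth (0, 0) hex_units i.
pose behind i := b (c + (dir i + dir i)).
have [r rP] := @even_cycle_avoiding_coloring 4 behind isT.
(* [hex_units] runs counterclockwise, so indices in it are the vertices of the 6-cycle. The centre
   may keep any value, here that of [b]. *)
pose f (h : hexagon) := if h - c \in hex_units then r (inord (index (h - c) hex_units))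
            else b h.
have fU (h : hexagon) : h - c \in hex_units -> f h = r (inord (index (h - c) hex_units)).
  by rewrite /f => ->.
have apart (h k : hexagon) : kept_apart (h - c) (k - c) -> f h <> f k.
  case/andP=> hU; rewrite (fU h hU).
  have lti : (index (h - c)%R hex_units < 6)%N by rewrite index_mem.
  case/andP: (rP (inord (index (h - c) hex_units))) => r_neqb r_neqr.
  case/orP=> [/eqP kE | /andP[kU /eqP kE]].
    apply/eqP; move: r_neqb; rewrite /behind /dir inordK // nth_index // -kE.
    have chk : all (fun u => u + u \notin hex_units) hex_units by [].
    by rewrite [c + _]addrC subrK /f {1}kE (negbTE (allP chk _ hU)).
  rewrite (fU k kU) kE; apply/eqP; congr (_ != r _): r_neqr.
  by apply: val_inj; rewrite /= !inordK ?ltn_mod // modnDmr addn1.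
exists f; split=> [h /ring3_not_adjacent | h1 h2 h3].
  by rewrite adjacentE /f => /negbTE ->.
move=> /disc3_ball2 B1 /disc3_ball2 B2 /disc3_ball2 B3.
rewrite !adjacentE => U12 U23 U13 [f12 f23].
have subc (x y : hexagon) : x - c - (y - c) = x - y by rewrite opprB addrA subrK.
have := triple_kept_apart B1 B2 B3; rewrite !subc => /(_ U12 U23 U13).
by case/or4P=> [|||/or3P[]] /apart; rewrite ?f12 ?f23.
Qed.
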